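(* Let $Q\in\mathcal{N}_{\kappa}(\mathcal{H})$ be holomorphic at $\infty$ and assume that $Q'(\infty):=\lim_{z\to\infty}zQ(z)$ is boundedly invertible. Let $Q(z)=\Gamma^{+}(A-z)^{-1}\Gamma$ be the minimal representation of $Q$, where $A$ is a bounded self-adjoint operator in a Pontryagin space $(\mathcal{K},[\cdot,\cdot])$ and $\Gamma:\mathcal{H}\to\mathcal{K}$ is a bounded operator; put $P:=\Gamma(\Gamma^{+}\Gamma)^{-1}\Gamma^{+}$ and $\tilde A:=(I-P)A|_{(I-P)\mathcal{K}}$. Then the inverse function $\hat Q(z):=-Q(z)^{-1}$ exists, and for all $z\in\mathcal{D}(Q)\cap\mathcal{D}(\hat Q)$ $$\hat Q(z)=(\Gamma^{+}\Gamma)^{-1}\Gamma^{+}\left\{A(I-P)(\tilde A-z)^{-1}(I-P)A-(A-zI)\right\}\Gamma(\Gamma^{+}\Gamma)^{-1}.$$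
   Context: $(\mathcal{H},(\cdot,\cdot))$ is a Hilbert space and $\mathcal{L}(\mathcal{H})$ the space of bounded operators on it. For an integer $\kappa\ge 0$, $\mathcal{N}_\kappa(\mathcal{H})$ is the class of functions $Q:\mathcal{D}(Q)\to\mathcal{L}(\mathcal{H})$ that are meromorphic in $\mathbb{C}\setminus\mathbb{R}$, satisfy $Q(z)^*=Q(\bar z)$, and whose kernel $\mathcal{N}_Q(z,w)=\frac{Q(z)-Q(w)^*}{z-\bar w}$, $z,w\in\mathcal{D}(Q)\cap\mathbb{C}^+$, has $\kappa$ negative squares (every Hermitian matrix $((\mathcal{N}_Q(z_i,z_j)h_i,h_j))_{i,j=1}^n$ has at most $\kappa$ negative eigenvalues, and for at least one choice of $n,z_i,h_i$ exactly $\kappa$). $\mathcal{D}(Q)$ is the domain of holomorphy of $Q$. ''$Q$ is holomorphic at $\infty$'' means that $Q$ is holomorphic in a neighbourhood of $\infty$ and the limit $Q'(\infty):=\lim_{z\to\infty}zQ(z)$ exists in the operator norm (so in particular $Q(\infty)=0$). Such $Q$ has a representation $Q(z)=\Gamma^{+}(A-z)^{-1}\Gamma$, $z\in\mathcal{D}(Q)=\rho(A)$, with $A$ a bounded self-adjoint operator in a Pontryagin space $(\mathcal{K},[\cdot,\cdot])$ and $\Gamma:\mathcal{H}\to\mathcal{K}$ bounded, which is minimal, i.e. $\mathcal{K}$ is the closed linear span of $\{(A-z)^{-1}\Gamma h: z\in\rho(A),h\in\mathcal{H}\}$ (then the negative index of $\mathcal{K}$ is $\kappa$), and $Q'(\infty)=-\Gamma^{+}\Gamma$.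 Here $\Gamma^{+}:\mathcal{K}\to\mathcal{H}$ is the adjoint: $(\Gamma^{+}k,h)=[k,\Gamma h]$. $P$ is an orthogonal projection in $\mathcal{K}$, and $(\tilde A-z)^{-1}$ denotes the resolvent of $\tilde A$ in $(I-P)\mathcal{K}$. $\mathcal{D}(Q)\cap\mathcal{D}(\hat Q)$ is the set of $z\in\mathcal{D}(Q)$ at which $Q(z)$ is boundedly invertible. *)

(* Defs.v *)
(* The complex field is R[i] over an abstract R : realType; its norm topology is
   the one carried by the alias R[i]^o. *)
Set Warnings "-notation-overridden,-ambiguous-paths,-notation-incompatible-prefix".
From HB Require Import structures.
From mathcomp Require Import all_boot all_order all_algebra sesquilinear.
From mathcomp Require Import complex.
From mathcomp Require Import all_classical all_reals topology normedtype.
Set Implicit Arguments.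
Unset Strict Implicit.
Unset Printing Implicit Defensive.
Import Num.Def Order.TTheory GRing.Theory Num.Theory numFieldNormedType.Exports.
Local Open Scope classical_set_scope.
Local Open Scope complex_scope.
Local Open Scope ring_scope.

Section BoundedOperators.
Variables (R : realType) (E F : normedModType R[i]).
Implicit Types (T : E -> F) (M : R[i]).

Definition opnorm_le T M := forall x, `|T x| <= M * `|x|.

Definition bounded_op T := linear T /\ exists M, opnorm_le T M.

(* convergence in operator norm along a filter on the complex plane *)
Definition op_cvg (f : R[i] -> E -> F) (G : set_system R[i]) (L : E -> F) :=
  bounded_op L /\
  forall e : R[i], 0 < e -> \forall z \near G, opnorm_le (f z \- L) e.

(* S is the adjoint of T: f (S y) x = g y (T x), where f and g are the
   (possibly indefinite) inner products of the two spaces *)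
Definition is_adjoint (f : E -> E -> R[i]) (g : F -> F -> R[i])
    (T : E -> F) (S : F -> E) :=
  forall y x, f (S y) x = g y (T x).

Definition adjoint (f : E -> E -> R[i]) (g : F -> F -> R[i]) (T : E -> F) :
    F -> E :=
  xget (fun=> 0) [set S | is_adjoint f g T S].

End BoundedOperators.

Section Inverses.
Variables (R : realType) (E : normedModType R[i]).
Implicit Types (M : set E) (T S A : E -> E).

(* S restricts to a bounded two-sided inverse of the restriction of T to the
   subspace M; linearity of S on M follows from that of T.  Values of S
   outside M are irrelevant. *)
Definition is_bounded_inverse_on M T S :=
  [/\ forall x, M x -> M (T x) /\ M (S x),
      forall x, M x -> T (S x) = x /\ S (T x) = x &
      exists c : R[i], forall x, M x -> `|S x| <= c * `|x|].

Definition boundedly_invertible_on M T := exists S, is_bounded_inverse_on M T S.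

Definition opinv_on M T : E -> E :=
  xget (fun=> 0) [set S | is_bounded_inverse_on M T S].

Definition boundedly_invertible T := boundedly_invertible_on setT T.
Definition opinv T := opinv_on setT T.

Definition resolvent_set_on M A : set R[i] :=
  [set z | boundedly_invertible_on M (A \- z \*: idfun)].

Definition resolvent_on M A (z : R[i]) : E -> E := opinv_on M (A \- z \*: idfun).

Definition resolvent_set A := resolvent_set_on setT A.
Definition resolvent A z := resolvent_on setT A z.

Definition subspace M :=
  M 0 /\ forall (a : R[i]) x y, M x -> M y -> M (a *: x + y).

Definition lin_span M : set E :=
  [set x | exists n (a : 'I_n -> R[i]) (v : 'I_n -> E),
    (forall i, M (v i)) /\ x = \sum_(i < n) a i *: v i].

Definition finite_dimensional M :=
  exists n (v : 'I_n -> E), M `<=` lin_span (range v).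

End Inverses.

(* The norm of the complete space K is only required to be equivalent to the
   Hilbert norm of a fundamental decomposition K = Kp [+] Km; all such norms
   are equivalent and define the topology of the Pontryagin space.  As K is
   complete and Kp is the orthogonal companion of Km, (Kp, [.,.]) is then a
   Hilbert space.  It is the negative component that is finite-dimensional. *)
Definition pontryagin (R : realType) (K : completeNormedModType R[i])
    (form : {hermitian K for false & conjC}) :=
  exists Kp Km : set K,
    [/\ subspace Kp /\ subspace Km,
        forall x, exists xp xm, [/\ Kp xp, Km xm & x = xp + xm],
        (forall x y, Kp x -> Km y -> form x y = 0)
        /\ (forall x, Kp x -> x != 0 -> 0 < form x x)
        /\ (forall x, Km x -> x != 0 -> form x x < 0),
        finite_dimensional Km &
        exists c d : R[i], [/\ 0 < c, 0 < d &
          forall xp xm, Kp xp -> Km xm ->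
            c * `|xp + xm| ^+ 2 <= form xp xp - form xm xm
              <= d * `|xp + xm| ^+ 2]].

Section OperatorFunctions.
Variables (R : realType) (H : completeNormedModType R[i]).

(* A function Q : D(Q) -> L(H) is a pair of a set D and a total function whose
   values outside D are irrelevant. *)
Implicit Types (D : set R[i]) (Q : R[i] -> H -> H).

Definition op_differentiable Q (z : R[i]) :=
  exists L, op_cvg (fun w => (w - z)^-1 \*: (Q w \- Q z)) (z : R[i]^o)^' L.

Definition op_holomorphic_on D Q :=
  open (D : set R[i]^o) /\ forall z, D z -> bounded_op (Q z) /\ op_differentiable Q z.

Definition domain_of_holomorphy D Q :=
  op_holomorphic_on D Q /\
  forall (U : set R[i]) (G : R[i] -> H -> H), op_holomorphic_on U G ->
    (forall z, U z -> D z -> G z = Q z) -> U `<=` D.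

(* At each nonreal point, some (z - z0)^n Q(z) has a holomorphic extension. *)
Definition meromorphic_off_real D Q :=
  forall z0 : R[i], z0 \isn't Num.real ->
    exists (n : nat) (U : set R[i]) (G : R[i] -> H -> H),
      [/\ U z0, op_holomorphic_on U G &
        forall z, U z -> z != z0 ->
          D z /\ G z = (z - z0) ^+ n \*: Q z].

Definition nevanlinna_kernel (ip : {dot H for conjC}) Q (z w : R[i]) : H -> H :=
  (z - conjC w)^-1 \*: (Q z \- adjoint ip ip (Q w)).

Definition neg_eigenvalues n (M : 'M[R[i]]_n) : nat :=
  count (fun x => x < 0) (sval (closed_field_poly_normal (char_poly M))).

Definition nevanlinna_gram (ip : {dot H for conjC}) Q n
    (z : 'I_n -> R[i]) (h : 'I_n -> H) : 'M[R[i]]_n :=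
  \matrix_(i, j) ip (nevanlinna_kernel ip Q (z i) (z j) (h i)) (h j).

Definition kernel_negative_squares (ip : {dot H for conjC}) (kappa : nat) D Q :=
  (forall n (z : 'I_n -> R[i]) (h : 'I_n -> H),
     (forall i, D (z i) /\ 0 < 'Im (z i)) ->
     (neg_eigenvalues (nevanlinna_gram ip Q z h) <= kappa)%N) /\
  (exists n (z : 'I_n -> R[i]) (h : 'I_n -> H),
     (forall i, D (z i) /\ 0 < 'Im (z i)) /\
     neg_eigenvalues (nevanlinna_gram ip Q z h) = kappa).

Definition gen_nevanlinna (ip : {dot H for conjC}) (kappa : nat) D Q :=
  [/\ domain_of_holomorphy D Q,
      meromorphic_off_real D Q,
      forall z, D z -> D (conjC z) /\ is_adjoint ip ip (Q z) (Q (conjC z)) &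
      kernel_negative_squares ip kappa D Q].

(* the filter of punctured neighbourhoods of infinity *)
Definition cinfty : set_system R[i] :=
  [set A | exists2 r : R[i], 0 < r & forall z, r < `|z| -> A z].

(* with Q' the value of Q'(oo) *)
Definition holomorphic_at_infty D Q (Q' : H -> H) :=
  (\forall z \near cinfty, D z) /\ op_cvg (fun z => z \*: Q z) cinfty Q'.

End OperatorFunctions.

Section Representation.
Variables (R : realType) (H K : completeNormedModType R[i]).
Variables (ip : {dot H for conjC}) (form : {hermitian K for false & conjC}).

(* G stands for Gamma and Gp for its adjoint Gamma^+ *)
Definition representation (D : set R[i]) (Q : R[i] -> H -> H)
    (A : K -> K) (G : H -> K) (Gp : K -> H) :=
  [/\ bounded_op A /\ is_adjoint form form A A,
      bounded_op G /\ is_adjoint ip form G Gp,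
      D = resolvent_set A &
      forall z, D z -> Q z = Gp \o resolvent A z \o G].

Definition minimal (A : K -> K) (G : H -> K) :=
  closure (lin_span [set k | exists z h, resolvent_set A z /\
                               k = resolvent A z (G h)]) = [set: K].

End Representation.

(* Main.v *)
Require Import Defs.
From HB Require Import structures.
From mathcomp Require Import all_boot all_order all_algebra sesquilinear.
From mathcomp Require Import complex ring.
From mathcomp Require Import all_classical all_reals topology normedtype.
Import Num.Def Order.TTheory GRing.Theory Num.Theory numFieldNormedType.Exports.
Local Open Scope classical_set_scope.
Local Open Scope complex_scope.
Local Open Scope ring_scope.

(* Since z (A - z)^-1 = A (A - z)^-1 - I and the first term on the right tends to
   0, Q'(oo) = - Gamma^+ Gamma, and z Q(z) is invertible near oo as a small
   perturbation of Q'(oo).  Let R = (A - z)^-1.  As (I - P) K = ker Gamma^+, the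
   Schur complement formula R - R Gamma Q(z)^-1 Gamma^+ R gives the resolvent of
   the compression.  If k = Gamma (Gamma^+ Gamma)^-1 h and
   x = (tA - z)^-1 (I - P) A k, then I - P annihilates (A - z)(x - k), so that
   (A - z)(x - k) = Gamma w; applying Gamma^+ R gives - h = Q(z) w, that is,
   w = - Q(z)^-1 h. *)

Lemma complex_half_expn_lt {R : realType} (c e : R[i]) :
  0 <= c -> 0 < e -> exists n, c * 2^-1 ^+ n < e.
Proof.
move=> c0 e0; have [m cem] : exists m : nat, c / e < m%:R.
  have ce0 : 0 <= c / e by rewrite divr_ge0// ltW.
  exists (Num.bound (complex.Re (c / e))).
  move: (c / e) ce0 => [a b]; rewrite lecE /= => /andP[/eqP-> a0].
  by rewrite -(rmorph_nat (real_complex R)) ltcR archi_boundP.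
exists m; rewrite exprVn ltr_pdivrMr ?exprn_gt0//.
move: cem; rewrite ltr_pdivrMr// mulrC => /lt_le_trans; apply.
by rewrite ler_pM2l// -natrX ler_nat ltnW// ltn_expl.
Qed.

Lemma half_lipschitz_fixed {R : realType} {E : completeNormedModType R[i]} (T : E -> E) :
  (forall x y, `|T x - T y| <= 2^-1 * `|x - y|) -> exists p, T p = p.
Proof.
move=> Tlip; pose u n := iter n T 0; pose c := `|T 0|.
have h0 : (0 : R[i]) < 2^-1 by rewrite invr_gt0.
have step n : `|u n.+1 - u n| <= c * 2^-1 ^+ n.
  elim: n => [|n ih]; first by rewrite /u /= subr0 expr0 mulr1.
  by apply: (le_trans (Tlip _ _)); rewrite exprS mulrCA ler_pM2l.
have dist n m : `|u (n + m)%N - u n| <= 2 * c * 2^-1 ^+ n - 2 * c * 2^-1 ^+ (n + m).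
  elim: m => [|m ih]; first by rewrite addn0 !subrr normr0.
  rewrite -[u (n + m.+1)%N](subrK (u (n + m)%N)) -addrA.
  apply: (le_trans (ler_normD _ _)).
  rewrite addnS; apply: le_trans (lerD (step _) ih) _.
  by rewrite exprS le_eqVlt; apply/orP; left; apply/eqP; field.
have c0 : 0 <= 2 * c by rewrite mulr_ge0// normr_ge0.
have close e : 0 < e -> exists N, forall n, (N <= n)%N -> `|u n - u N| < e.
  move=> /(complex_half_expn_lt _ _ c0)[N HN]; exists N => n Nn.
  rewrite -(subnKC Nn); apply: le_lt_trans (dist _ _) (le_lt_trans _ HN).
  by rewrite gerBl mulr_ge0// exprn_ge0// ltW.
have /cauchy_cvgP/cvg_ex[p up] : cauchy (u @ \oo).
  apply: cauchy_exP => e e0; have [N HN] := close _ e0.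
  exists (u N); exists N => // n /= Nn; rewrite -ball_normE /=.
  by rewrite distrC HN.
exists p; apply/eqP; rewrite -subr_eq0 -normr_le0.
apply/ler_addgt0Pl => e e0; rewrite addr0.
have e20 : 0 < e / 2 by rewrite divr_gt0.
have /cvgrPdist_lt /(_ _ e20) [N _ HN] := up.
have := HN _ (leqnn N); have := HN _ (leqnSn N) => /= h1 h2.
rewrite -[T p](subrK (T (u N))) -addrA (le_trans (ler_normD _ _))//.
rewrite [e]splitr lerD//; last by rewrite distrC ltW.
apply: (le_trans (Tlip _ _)); apply: le_trans _ (ltW h2).
by rewrite ler_piMl// invf_le1// ler1n.
Qed.

Section BoundedOperators.
Context {R : realType} {E F : normedModType R[i]}.

Lemma linear_packP {U V : lmodType R[i]} (T : U -> V) :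
  linear T -> exists S : {linear U -> V}, T = S.
Proof.
move=> TL.
by exists (HB.pack_for {linear U -> V} T (GRing.isLinear.Build _ _ _ _ T TL)).
Qed.

Lemma opnorm_le_gt0 (T : E -> F) :
  (exists c, opnorm_le T c) -> exists2 c : R[i], 0 < c & opnorm_le T c.
Proof.
move=> [c Tc]; exists (`|c| + 1); first by rewrite ltr_wpDl.
move=> x; have Tcx := Tc x; have cx0 : 0 <= c * `|x| := le_trans (normr_ge0 _) Tcx.
apply: (le_trans Tcx); rewrite -(ger0_norm cx0) normrM normr_id ler_wpM2r//.
by rewrite lerDl.
Qed.

Lemma bounded_op_gt0 (T : E -> F) :
  bounded_op T -> exists2 c : R[i], 0 < c & opnorm_le T c.
Proof. by move=> [_ /opnorm_le_gt0]. Qed.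

End BoundedOperators.

Section BoundedInverses.
Context {R : realType} {E : normedModType R[i]}.
Implicit Types (M : set E) (T S : E -> E).

Lemma opinv_onP M T :
  boundedly_invertible_on M T -> is_bounded_inverse_on M T (opinv_on M T).
Proof. exact: xgetPex. Qed.

Lemma opinvP T : boundedly_invertible T ->
  [/\ cancel (opinv T) T, cancel T (opinv T) &
      exists2 c : R[i], 0 < c & opnorm_le (opinv T) c].
Proof.
move=> /opinv_onP[_ TS [c Sc]]; split=> [x|x|].
- by have [] := TS x I.
- by have [] := TS x I.
- by apply: opnorm_le_gt0; exists c => x; exact: Sc.
Qed.

Lemma can_boundedly_invertible T S :
  cancel S T -> cancel T S -> (exists c, opnorm_le S c) -> boundedly_invertible T.
Proof. by move=> ST TS [c Sc]; exists S; split => //; exists c. Qed.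

Lemma inverse_linear (U : lmodType R[i]) (T S : U -> U) :
  linear T -> cancel S T -> cancel T S -> linear S.
Proof.
by move=> /linear_packP[T' ->] ST TS; exact: (GRing.can2_linear TS ST).
Qed.

End BoundedInverses.

Lemma boundedly_invertible_perturb {R : realType} {E : completeNormedModType R[i]}
    (T S : E -> E) (c e : R[i]) :
  linear T -> linear S -> boundedly_invertible T ->
  0 < c -> opnorm_le (opinv T) c -> c * e <= 2^-1 -> opnorm_le (S \- T) e ->
  boundedly_invertible S.
Proof.
move=> TL SL /opinvP[VT TV _] c0; move: (opinv T) VT TV => V VT TV Vc ce STe.
have [V' VE] := linear_packP _ (inverse_linear _ _ _ TL VT TV); subst V.
have [T' TE] := linear_packP _ TL; subst T.
have [S' SE] := linear_packP _ SL; subst S.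
have contr x : `|V' (S' x - T' x)| <= 2^-1 * `|x|.
  apply: (le_trans (Vc _)); apply: le_trans (ler_wpM2r (normr_ge0 x) ce).
  by rewrite -mulrA ler_pM2l// STe.
have below x : `|x| <= 2 * c * `|S' x|.
  have xE : x = V' (S' x) - V' (S' x - T' x) by rewrite -linearB opprB addrC subrK TV.
  have : `|x| <= c * `|S' x| + 2^-1 * `|x|.
    by rewrite {1}xE (le_trans (ler_normB _ _))// lerD.
  rewrite -lerBlDr -[X in X - _]mul1r -mulrBl => h.
  rewrite -mulrA -ler_pdivrMl//; apply: le_trans h.
  by rewrite le_eqVlt; apply/orP; left; apply/eqP; field.
have Sinj x y : S' x = S' y -> x = y.
  move=> xy; apply/eqP; rewrite -subr_eq0 -normr_le0.
  by apply: (le_trans (below _)); rewrite linearB xy subrr normr0 mulr0.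
have Ssurj y : exists x, S' x = y.
  (* a fixed point x satisfies T x = y - (S x - T x) *)
  have [|x xE] := half_lipschitz_fixed (fun x => V' (y - (S' x - T' x))).
    have subE a b : y - a - (y - b) = - (a - b).
      by rewrite opprB addrC addrA subrK opprB.
    move=> x x'; rewrite -linearB subE linearN normrN.
    suff -> : S' x - T' x - (S' x' - T' x') = S' (x - x') - T' (x - x') by [].
    by rewrite !linearB /= addrACA.
  exists x; move/(congr1 T'): xE; rewrite VT opprB addrCA => /eqP.
  by rewrite -subr_eq0 addrAC subrr add0r subr_eq0 => /eqP.
have [S'' SS''] := choice Ssurj; exists S''; split => // [x _|].
  by split; [exact: SS''|apply: Sinj; exact: SS''].
by exists (2 * c) => x _; rewrite -{2}(SS'' x).
Qed.

Section HermitianForm.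
Context {R : realType} {K : completeNormedModType R[i]}.
Variable form : {hermitian K for false & conjC}.

Lemma herm_conj x y : form y x = (form x y)^*%R.
Proof. by have := hermC form y x; rewrite expr0 mul1r. Qed.

Lemma subspaceZ (M : set K) a x : Defs.subspace M -> M x -> M (a *: x).
Proof. by move=> [M0 Mlin] Mx; rewrite -[_ *: _]addr0; exact: Mlin. Qed.

Lemma subspaceB (M : set K) x y : Defs.subspace M -> M x -> M y -> M (x - y).
Proof. by move=> [M0 Mlin] Mx My; rewrite addrC -scaleN1r; exact: Mlin. Qed.

(* e is 1 on the positive and -1 on the negative component of a Pontryagin space. *)
Lemma definite_CauchySchwarz (e : R[i]) (M : set K) :
  e^*%R = e -> Defs.subspace M -> (forall x, M x -> x != 0 -> 0 < e * form x x) ->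
  forall x y, M x -> M y ->
  `|e * form x y| ^+ 2 <= (e * form x x) * (e * form y y).
Proof.
move=> eC MS Mpos x y Mx My.
have [->|y0] := eqVneq y 0; first by rewrite !linear0r !mulr0 normr0 expr0n.
have ge0 z : M z -> 0 <= e * form z z.
  move=> Mz; have [->|z0] := eqVneq z 0; first by rewrite linear0l mulr0.
  by rewrite ltW// Mpos.
set b := e * form y y; have b0 : 0 < b by exact: Mpos.
set a := e * form x x; set c := e * form x y.
have bC : b^*%R = b by exact/geC0_conj/ltW.
have : 0 <= e * form (b *: x - c *: y) (b *: x - c *: y).
  by apply: ge0; apply: subspaceB => //; exact: subspaceZ.
have -> : e * form (b *: x - c *: y) (b *: x - c *: y) = b * (a * b - `|c| ^+ 2).
  rewrite linearBl !linearBr /= !linearZl_LR !linearZr_LR /= bC [form y x]herm_conj.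
  have -> : e * (b * (b * form x x) - b * (c^*%R * form x y) -
     (c * (b * (form x y)^*%R) - c * (c^*%R * form y y))) =
     b * b * a - b * c^*%R * c - b * c * (e * (form x y)^*%R) + c * c^*%R * b.
    by rewrite /a /c /b; ring.
  have -> : e * (form x y)^*%R = c^*%R by rewrite rmorphM /= eC.
  by rewrite normCK; ring.
by rewrite pmulr_rge0// subr_ge0.
Qed.

Lemma pontryagin_bounded : pontryagin form ->
  exists2 c : R[i], 0 < c & forall x y, `|form x y| <= c * `|x| * `|y|.
Proof.
move=> [Kp [Km [[Kp0 Km0] Kdec [Kort [Kpos Kneg]] _ [c [d [_ d0 Kd]]]]]].
have CS e M x y (a b : R[i]) : e^*%R = e -> `|e| = 1 -> Defs.subspace M ->
    (forall z, M z -> z != 0 -> 0 < e * form z z) -> M x -> M y ->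
    0 <= a -> 0 <= b -> e * form x x <= d * a ^+ 2 -> e * form y y <= d * b ^+ 2 ->
    `|form x y| <= d * a * b.
  move=> eC e1 MS Mpos Mx My a0 b0 xa yb.
  have ge0 z : M z -> 0 <= e * form z z.
    move=> Mz; have [->|z0] := eqVneq z 0; first by rewrite linear0l mulr0.
    by rewrite ltW// Mpos.
  rewrite -[leLHS]mul1r -e1 -normrM -ler_sqr ?nnegrE ?mulr_ge0// ?(ltW d0)//.
  apply: (le_trans (definite_CauchySchwarz _ _ eC MS Mpos _ _ Mx My)).
  apply: le_trans (ler_pM (ge0 _ Mx) (ge0 _ My) xa yb) _.
  by rewrite le_eqVlt; apply/orP; left; apply/eqP; ring.
exists (2 * d) => [|x y]; first by rewrite mulr_gt0.
have split_le z zp zm : Kp zp -> Km zm -> z = zp + zm ->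
    1 * form zp zp <= d * `|z| ^+ 2 /\ -1 * form zm zm <= d * `|z| ^+ 2.
  move=> Kzp Kzm ->; have /andP[_] := Kd _ _ Kzp Kzm.
  have p0 : 0 <= form zp zp.
    by have [->|z0] := eqVneq zp 0; rewrite ?linear0l// ltW// Kpos.
  have m0 : 0 <= - form zm zm.
    by rewrite oppr_ge0; have [->|z0] := eqVneq zm 0; rewrite ?linear0l// ltW// Kneg.
  by move=> h; rewrite mul1r mulN1r; split; apply: le_trans h; rewrite ?lerDl ?lerDr.
have [xp [xm [Kxp Kxm xE]]] := Kdec x; have [yp [ym [Kyp Kym yE]]] := Kdec y.
have [xp_le xm_le] := split_le _ _ _ Kxp Kxm xE.
have [yp_le ym_le] := split_le _ _ _ Kyp Kym yE.
have -> : form x y = form xp yp + form xm ym.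
  rewrite xE yE linearDl !linearDr /= (Kort xp ym)// (herm_conj yp xm).
  by rewrite (Kort yp xm)// rmorph0 addr0 add0r.
rewrite (le_trans (ler_normD _ _))// -!mulrA mulr_natl mulr2n !mulrA lerD//.
- apply: (CS 1 Kp) => //; rewrite ?rmorph1 ?normr1// => z Kz z0.
  by rewrite mul1r Kpos.
- apply: (CS (-1) Km) => //; rewrite ?rmorphN1 ?normrN1// => z Kz z0.
  by rewrite mulN1r oppr_gt0 Kneg.
Qed.

End HermitianForm.

Section Adjoint.
Context {R : realType} {H K : completeNormedModType R[i]}.
Variables (ip : {dot H for conjC}) (form : {hermitian K for false & conjC}).
Variables (G : H -> K) (Gp : K -> H).
Hypothesis adjG : is_adjoint ip form G Gp.

Lemma adjoint_linear : linear Gp.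
Proof.
move=> a x y; apply/eqP; rewrite -subr_eq0 -(dnorm_eq0 ip).
set h := (X in ip X X); suff -> : ip h h = 0 by [].
by rewrite {1}/h linearBl linearDl linearZl_LR /= !adjG linearDl linearZl_LR subrr.
Qed.

Lemma adjoint_bounded : (forall h, ip h h = `|h| ^+ 2) -> pontryagin form ->
  bounded_op G -> exists c, opnorm_le Gp c.
Proof.
move=> ip_norm /pontryagin_bounded[c c0 form_le] /bounded_op_gt0[g g0 Gg].
exists (c * g) => k; have [->|Gk0] := eqVneq (Gp k) 0.
  by rewrite normr0 !mulr_ge0// ltW.
have Gk_gt0 : 0 < `|Gp k| by rewrite normr_gt0.
rewrite -(ler_pM2r Gk_gt0) -expr2 -ip_norm.
rewrite -[leLHS]ger0_norm ?ip_norm ?exprn_ge0// -ip_norm adjG.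
apply: (le_trans (form_le _ _)).
by rewrite -!mulrA ler_pM2l// mulrCA ler_wpM2l.
Qed.

End Adjoint.

Section Compression.
Context {R : realType} {H K : completeNormedModType R[i]}.
Variables (A : {linear K -> K}) (G : {linear H -> K}) (Gp : {linear K -> H}).
Variables (W : {linear H -> H}).
Hypothesis GW : cancel W (Gp \o G).
Hypothesis WG : cancel (Gp \o G) W.

Let IP : K -> K := idfun \- (G \o W \o Gp).

Lemma range_compression x : range IP x <-> Gp x = 0.
Proof.
split=> [[y _ <-]|Gx0]; last by exists x => //; rewrite /IP /= Gx0 !linear0 addr0.
by rewrite /IP /= linearB; move: (GW (Gp y)) => /= ->; rewrite subrr.
Qed.

Lemma compression_id x : Gp x = 0 -> IP x = x.
Proof. by move=> Gx0; rewrite /IP /= Gx0 !linear0 addr0. Qed.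

Lemma compression0 w : IP (G w) = 0.
Proof. by rewrite /IP /=; move: (WG w) => /= ->; rewrite subrr. Qed.

Lemma compressionB x y : IP (x - y) = IP x - IP y.
Proof. by rewrite /IP /= !linearB /= addrACA. Qed.

Lemma compressionZ a x : IP (a *: x) = a *: IP x.
Proof. by rewrite /IP /= !linearZ /= scalerDr. Qed.

Variables (z : R[i]) (Rz : {linear K -> K}) (V : {linear H -> H}).
Hypothesis AR : cancel Rz (A \- z \*: idfun).
Hypothesis RA : cancel (A \- z \*: idfun) Rz.
Hypothesis QV : cancel V (Gp \o Rz \o G).
Hypothesis VQ : cancel (Gp \o Rz \o G) V.

Lemma compression_resolvent :
  (exists c, opnorm_le Rz c) -> (exists c, opnorm_le G c) ->
  (exists c, opnorm_le Gp c) -> (exists c, opnorm_le V c) ->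
  resolvent_set_on (range IP) (IP \o A) z.
Proof.
move=> Rc Gc Gpc Vc; exists (fun n => Rz (n - G (V (Gp (Rz n))))).
have ARE x : A (Rz x) - z *: Rz x = x := AR x.
have RAE x : Rz (A x - z *: x) = x := RA x.
have QVE x : Gp (Rz (G (V x))) = x := QV x.
have VQE x : V (Gp (Rz (G x))) = x := VQ x.
have compr x : Gp x = 0 -> ((IP \o A) \- z \*: idfun) x = IP (A x - z *: x).
  by move=> x0; rewrite compressionB compressionZ (compression_id x).
have S0 n : Gp (Rz (n - G (V (Gp (Rz n))))) = 0.
  by rewrite !linearB /= QVE subrr.
split=> [x /range_compression x0|x /range_compression x0|].
- split; last exact/range_compression.
  by rewrite compr//; exists (A x - z *: x).
- split; first by rewrite compr// ARE compressionB compression0 subr0 compression_id.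
  rewrite compr//; set w := W (Gp (A x - z *: x)).
  have -> : IP (A x - z *: x) = A x - z *: x - G w by [].
  have RE : Rz (A x - z *: x - G w) = x - Rz (G w) by rewrite [LHS]linearB RAE.
  have VE : V (Gp (Rz (A x - z *: x - G w))) = - w.
    by rewrite RE [Gp _]linearB x0 sub0r linearN /= VQE.
  by rewrite VE linearN opprK subrK RAE.
have [r r0 Rr] := opnorm_le_gt0 _ Rc; have [g g0 Gg] := opnorm_le_gt0 _ Gc.
have [p p0 Gpp] := opnorm_le_gt0 _ Gpc; have [v v0 Vv] := opnorm_le_gt0 _ Vc.
exists (r * (1 + g * v * p * r)) => x _; apply: (le_trans (Rr _)).
rewrite -[leRHS]mulrA ler_pM2l// mulrDl mul1r (le_trans (ler_normB _ _))// lerD2l.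
apply: (le_trans (Gg _)); rewrite -!mulrA ler_pM2l//.
apply: (le_trans (Vv _)); rewrite ler_pM2l//.
by apply: (le_trans (Gpp _)); rewrite ler_pM2l.
Qed.

Lemma compression_formula (S : K -> K) h :
  is_bounded_inverse_on (range IP) ((IP \o A) \- z \*: idfun) S ->
  let k := G (W h) in
  - V h = W (Gp (A (IP (S (IP (A k)))) - (A k - z *: k))).
Proof.
move=> [NS SN _] k; set n := IP (A k); have Nn : range IP n by exists (A k).
have [/= Sn _] := SN _ Nn; have [_ /range_compression] := NS _ Nn.
move: (S n) Sn => x Sn x0; rewrite compression_id//.
have k0 : IP k = 0 := compression0 _.
pose u := A (x - k) - z *: (x - k); pose w := W (Gp u).
have uE : u = A x - z *: x - (A k - z *: k).
  by rewrite /u linearB scalerBr !opprD !opprK addrACA.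
have uG : u = G w.
  apply/eqP; rewrite -subr_eq0; apply/eqP; change (IP u = 0).
  have <- : IP (A x - z *: x) - IP (A k - z *: k) = 0.
    rewrite [X in X - _]compressionB compressionZ (compression_id x)//.
    rewrite (compressionB (A k)) compressionZ k0 scaler0 subr0.
    by apply/eqP; rewrite subr_eq0; apply/eqP; exact: Sn.
  by rewrite uE compressionB.
have xk : x - k = Rz (G w) by rewrite -uG; exact/esym/RA.
have hw : - h = Gp (Rz (G w)).
  by rewrite -xk linearB x0 sub0r; move: (GW h) => /= ->.
rewrite -[LHS]linearN hw [LHS]VQ /w uE.
have -> : A x - z *: x - (A k - z *: k) = A x - (A k - z *: k) - z *: x.
  by rewrite addrAC.
by rewrite [in LHS]linearB [Gp (z *: x)]linearZ /= x0 scaler0 subr0.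
Qed.

End Compression.

Section Infinity.
Context {R : realType}.
Implicit Types (P S : set R[i]).

Lemma cinftyI P S : cinfty P -> cinfty S -> cinfty (P `&` S).
Proof.
move=> [r r0 rP] [s s0 sS]; exists (r + s); first exact: addr_gt0.
by move=> z rsz; split; [apply: rP|apply: sS]; apply: le_lt_trans rsz;
  rewrite ?lerDl ?lerDr ltW.
Qed.

Lemma cinfty_ex P : cinfty P -> exists z, P z.
Proof.
move=> [r r0 rP]; exists (r + 1); apply: rP.
by rewrite gtr0_norm ?addr_gt0// ltrDl.
Qed.

Lemma resolvent_infty {K : normedModType R[i]} (A : K -> K) (a z : R[i]) :
  opnorm_le A a -> resolvent_set A z -> a < `|z| ->
  forall y, `|resolvent A z y| <= (`|z| - a)^-1 * `|y|.
Proof.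
move=> Aa /opinvP[AR _ _] az y; rewrite ler_pdivlMl ?subr_gt0//.
set x := resolvent A z y; have <- : A x - z *: x = y := AR y.
rewrite mulrBl lerBlDr -normrZ -{1}[z *: x](subrK (A x)) (le_trans (ler_normD _ _))//.
by rewrite distrC lerD.
Qed.

Lemma transfer_infty {H K : normedModType R[i]} (A : {linear K -> K})
    (G : {linear H -> K}) (Gp : {linear K -> H}) :
  bounded_op A -> bounded_op G -> bounded_op Gp -> forall e : R[i], 0 < e ->
  cinfty [set z | resolvent_set A z ->
    opnorm_le (z \*: (Gp \o resolvent A z \o G) \- (fun h => - Gp (G h))) e].
Proof.
move=> /bounded_op_gt0[a a0 Aa] /bounded_op_gt0[g g0 Gg] /bounded_op_gt0[p p0 Gpp] e e0.
exists (a + p * a * g / e); first by rewrite addr_gt0// divr_gt0// !mulr_gt0.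
move=> z; rewrite -ltrBrDl => zlt Az h /=.
have za : 0 < `|z| - a by apply: lt_trans zlt; rewrite divr_gt0// !mulr_gt0.
have [/(_ (G h)) /= AR _ _] := opinvP _ Az.
rewrite opprK -linearZ -linearD /=.
set x := resolvent A z (G h); have -> : z *: x + G h = A x.
  by rewrite -{1}AR addrC subrK.
apply: (le_trans (Gpp _)); apply: le_trans (_ : p * (a * ((`|z| - a)^-1 * (g * `|h|))) <= _).
  rewrite ler_pM2l//; apply: (le_trans (Aa _)); rewrite ler_pM2l//.
  apply: le_trans (resolvent_infty _ _ _ Aa Az _ _) _; first by rewrite -subr_gt0.
  by rewrite ler_pM2l ?invr_gt0.
have -> : p * (a * ((`|z| - a)^-1 * (g * `|h|))) = p * a * g / (`|z| - a) * `|h|.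
  by rewrite !mulrA; congr (_ * _); rewrite mulrAC.
apply: ler_wpM2r => //; rewrite ler_pdivrMr// -ler_pdivrMl// mulrC; exact: ltW.
Qed.

Lemma op_cvg_infty_unique {E F : normedModType R[i]} (f : R[i] -> E -> F) (S T : E -> F) :
  op_cvg f (@cinfty R) S ->
  (forall e : R[i], 0 < e -> cinfty [set z | opnorm_le (f z \- T) e]) ->
  S = T.
Proof.
move=> [_ fS] fT; apply: funext => h; apply/eqP; rewrite -subr_eq0 -normr_le0.
apply/ler_addgt0Pl => e e0; rewrite addr0.
have d0 : 0 < e / 2 / (`|h| + 1) by rewrite !divr_gt0// ltr_wpDl.
have /cinfty_ex[z [zS zT]] := cinftyI _ _ (fS _ d0) (fT _ d0).
rewrite -[S h](subrK (f z h)) -addrA (le_trans (ler_normD _ _))//.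
have small : e / 2 / (`|h| + 1) * `|h| <= e / 2.
  rewrite mulrAC ler_pdivrMr ?ltr_wpDl// ler_wpM2l ?lerDl//.
  by rewrite ltW// divr_gt0.
rewrite distrC [e]splitr; apply: lerD.
  exact: le_trans (zS h) small.
exact: le_trans (zT h) small.
Qed.


Lemma op_cvg_infty_invertible {E : completeNormedModType R[i]} (f : R[i] -> E -> E)
    (S : E -> E) :
  op_cvg f (@cinfty R) S -> boundedly_invertible S ->
  cinfty [set z | linear (f z) -> boundedly_invertible (f z)].
Proof.
move=> [[SL _] fS] Sinv; have [_ _ [c c0 Sc]] := opinvP _ Sinv.
have e0 : 0 < c^-1 / 2 by rewrite divr_gt0// invr_gt0.
have [r r0 fr] := fS _ e0; exists r => // z rz fL.
apply: (boundedly_invertible_perturb S (f z) c (c^-1 / 2)) => //; last exact: fr.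
by rewrite mulrA divff ?mul1r// gt_eqF.
Qed.

Lemma scaled_boundedly_invertible {E : normedModType R[i]} (T : E -> E) (z : R[i]) :
  linear T -> z != 0 -> boundedly_invertible (z \*: T) -> boundedly_invertible T.
Proof.
move=> /linear_packP[T' ->] z0 /opinvP[TS ST [c _ Sc]].
move: (opinv _) TS ST Sc => S TS ST Sc.
apply: (can_boundedly_invertible T' (fun y => S (z *: y))).
- by move=> y; apply: (scalerI z0); exact: TS.
- by move=> x; exact: ST.
- by exists (c * `|z|) => y; apply: (le_trans (Sc _)); rewrite normrZ mulrA.
Qed.

End Infinity.

Theorem theorem3p2 (R : realType)
    (H : completeNormedModType R[i]) (ip : {dot H for conjC})
    (ip_norm : forall h : H, ip h h = `|h| ^+ 2)
    (kappa : nat) (D : set R[i]) (Q : R[i] -> H -> H)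
    (Q_nevanlinna : gen_nevanlinna ip kappa D Q)
    (Q' : H -> H) (Q_infty : holomorphic_at_infty D Q Q')
    (Q'_inv : boundedly_invertible Q')
    (K : completeNormedModType R[i]) (form : {hermitian K for false & conjC})
    (K_pontryagin : pontryagin form)
    (A : K -> K) (G : H -> K) (Gp : K -> H)
    (Q_repr : representation ip form D Q A G Gp)
    (Q_min : minimal A G) :
  let GGi := opinv (Gp \o G) in
  let P := G \o GGi \o Gp in
  let IP := idfun \- P in
  let tA := IP \o A in
  let Qhat := fun z => \- opinv (Q z) in
  [/\ boundedly_invertible (Gp \o G),
      \forall z \near @cinfty R, D z /\ boundedly_invertible (Q z) &
      forall z, D z -> boundedly_invertible (Q z) ->
        resolvent_set_on (range IP) tA z /\
        Qhat z =
          GGi \o Gp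
          \o ((A \o IP \o resolvent_on (range IP) tA z \o IP \o A)
              \- (A \- z \*: idfun))
          \o G \o GGi].
Proof.
move=> GGi P IP tA Qhat.
have [[[_ Qhol] _] _ _ _] := Q_nevanlinna.
have Qlin z : D z -> linear (Q z) by move=> /Qhol[[]].
have [D_infty Q_cvg] := Q_infty.
have [[Ab _] [Gb adjG] DE Qrepr] := Q_repr.
have Gpb : bounded_op Gp.
  by split; [exact: adjoint_linear adjG|exact: adjoint_bounded adjG ip_norm K_pontryagin Gb].
have QE : Q' = (fun h => - Gp (G h)).
  apply: (op_cvg_infty_unique _ _ _ Q_cvg) => e e0.
  have [[A' AE] [G' GE]] := (linear_packP _ (proj1 Ab), linear_packP _ (proj1 Gb)).
  have [Gp' GpE] := linear_packP _ (proj1 Gpb); subst A G Gp.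
  have [r r0 Hr] := cinftyI _ _ D_infty (transfer_infty _ _ _ Ab Gb Gpb _ e0).
  exists r => // z /Hr[Dz Hz]; rewrite /= (Qrepr _ Dz); apply: Hz.
  by rewrite -DE.
have GpG_inv : boundedly_invertible (Gp \o G).
  have [VQ' QV' [c _ Vc]] := opinvP _ Q'_inv; move: (opinv Q') VQ' QV' Vc => V VQ' QV' Vc.
  have Q'E h : Q' h = - Gp (G h) by rewrite QE.
  have [V' VE] := linear_packP _ (inverse_linear _ _ _ (proj1 (proj1 Q_cvg)) VQ' QV'); subst V.
  apply: (can_boundedly_invertible _ (fun h => V' (- h))).
  - by move=> h; rewrite -[LHS]opprK -[X in - X]Q'E VQ' opprK.
  - by move=> h; rewrite -[RHS]QV' Q'E.
  - by exists c => h; rewrite -[X in _ * X]normrN.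
split => //.
  have [r r0 Hr] := cinftyI _ _ D_infty (op_cvg_infty_invertible _ _ Q_cvg Q'_inv).
  exists r => // z rz; have [Dz zQ_inv] := Hr z rz; split => //.
  apply: (scaled_boundedly_invertible _ z) (Qlin _ Dz) _ (zQ_inv _).
    by rewrite -normr_gt0 (lt_trans r0).
  have [Q1 ->] := linear_packP _ (Qlin _ Dz).
  by move=> a x y /=; rewrite linearP scalerDr !scalerA mulrC.
move=> z Dz Qz_inv.
have [WG GW _] : [/\ cancel GGi (Gp \o G), cancel (Gp \o G) GGi & _] := opinvP _ GpG_inv.
have Wlin : linear GGi.
  by apply: inverse_linear WG GW; move=> a x y /=; rewrite (proj1 Gb) (proj1 Gpb).
have [VQ QV Vc] := opinvP _ Qz_inv.
have Vlin := inverse_linear _ _ _ (Qlin _ Dz) VQ QV.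
have [AR RA Rc] : [/\ cancel (resolvent A z) (A \- z \*: idfun),
    cancel (A \- z \*: idfun) (resolvent A z) &
      exists2 c : R[i], 0 < c & opnorm_le (resolvent A z) c].
  by apply: opinvP; rewrite DE in Dz.
have Rlin : linear (resolvent A z).
  apply: inverse_linear AR RA => a x y /=.
  by rewrite (proj1 Ab) scalerBr scalerDr !scalerA mulrC opprD addrACA.
rewrite {}/Qhat {}/tA {}/IP {}/P.
move: (opinv (Q z)) VQ QV Vc Vlin; rewrite (Qrepr _ Dz) => V VQ QV [v _ Vv] Vlin.
move: GGi WG GW Wlin => W WG GW Wlin.
move: (resolvent A z) AR RA Rc Rlin VQ QV => Rz AR RA [r _ Rr] Rlin VQ QV.
have [_ [g Gg]] := Gb; have [_ [p Gpp]] := Gpb.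
have [[A' AE] [G' GE]] := (linear_packP _ (proj1 Ab), linear_packP _ (proj1 Gb)).
have [[Gp' GpE] [W' WE]] := (linear_packP _ (proj1 Gpb), linear_packP _ Wlin).
have [[R' RE] [V' VE]] := (linear_packP _ Rlin, linear_packP _ Vlin).
rewrite {}AE {}GE {}GpE {}WE {}RE {}VE in Gg Gpp Rr Vv AR RA VQ QV WG GW *.
have tA_res := compression_resolvent A' G' Gp' W' WG GW z R' V' AR RA VQ QV
  (ex_intro _ r Rr) (ex_intro _ g Gg) (ex_intro _ p Gpp) (ex_intro _ v Vv).
split => //; apply: funext => h.
exact: (compression_formula _ _ _ _ WG GW _ _ _ RA QV _ h (opinv_onP _ _ tA_res)).
Qed.
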